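(* Let $a$ and $b$ be relatively prime positive integers. For every nonnegative integer $n$, $$\sum_{\substack{0\le a_1\le b-1\\ 0\le b_1\le a-1}} (aa_1+bb_1)^{n}\,\chi_{a_1,b_1}=\sum_{i=0}^{n}\binom{n}{i}a^{i}b^{i}S_{n-i}.$$
   Context: For integers $a_1,b_1$ with $0\le a_1\le b-1$ and $0\le b_1\le a-1$, $\chi_{a_1,b_1}=1$ if $aa_1+bb_1-ab>0$ and $\chi_{a_1,b_1}=0$ if $aa_1+bb_1-ab<0$ (equality $aa_1+bb_1=ab$ does not occur in these ranges). Let $\mathrm{NR}(a,b)=\{n\in\mathbb{N}: n\ne ax+by \text{ for any } x,y\in\mathbb{Z}_{\ge 0}\}$, where $\mathbb{N}$ denotes the positive integers; this set is finite. For an integer $k\ge 0$, $S_k=S_k(a,b)=\sum_{n\in\mathrm{NR}(a,b)} n^k$. Convention: $0^0=1$. *)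

(* Defs.v *)
From mathcomp Require Import all_boot all_order all_algebra.
From mathcomp Require Import classical_sets fsbigop.

Set Implicit Arguments.
Unset Strict Implicit.
Unset Printing Implicit Defensive.

Local Open Scope nat_scope.
Local Open Scope classical_set_scope.

(* The difference is computed in [int], since subtraction on [nat] truncates.
   For coprime [a], [b] and [a1 < b], [b1 < a] it never vanishes, so the value
   0 is taken exactly when it is negative. *)
Definition chi (a b a1 b1 : nat) : nat :=
  if (0 < a%:Z * a1%:Z + b%:Z * b1%:Z - a%:Z * b%:Z)%R then 1 else 0.

Definition NR (a b : nat) : set nat :=
  [set n | 0 < n /\ forall x y : nat, n <> a * x + b * y].

(* A sum over a classical set is by convention 0 when its support is infinite;
   for coprime positive [a], [b] the set [NR a b] is finite. *)
Definition S_ (k a b : nat) : nat :=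
  \big[addn/0]_(n \in NR a b) n ^ k.

(* Main.v *)
(* Translating by [a * b] maps [NR a b] bijectively onto the values
   [a * a1 + b * b1 > a * b] with [a1 < b] and [b1 < a], so both sides equal
   the sum of [(m + a * b) ^ n] over [m] in [NR a b], the right-hand one by
   the binomial theorem. *)
Require Import Defs.
From mathcomp Require Import all_boot all_order all_algebra.
From mathcomp Require Import classical_sets fsbigop.
From mathcomp Require Import zify.

Local Open Scope nat_scope.

Lemma chiE (a b a1 b1 : nat) : chi a b a1 b1 = (a * b < a * a1 + b * b1).
Proof.
rewrite /chi; case: ifP; case: ltnP => //; lia.
Qed.

(** Modulo [b] only [a * x] and [a * x'] survive, and [a], coprime to [b], cancels. *)
Lemma eq_mod_of_comb (a b x y x' y' : nat) : coprime a b ->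
  a * x + b * y = a * x' + b * y' -> x = x' %[mod b].
Proof.
move=> hab e; apply/eqP.
have h : a * x == a * x' %[mod b].
  by rewrite -(modnMDl y (a * x)) -(modnMDl y' (a * x')) ![_ * b + _]addnC
             ![_ * b]mulnC e.
move: h; clear e; wlog le : x x' / x <= x'.
  move=> W; case/orP: (leq_total x x') => /W // {}W.
  by rewrite eq_sym => /W; rewrite eq_sym.
rewrite eq_sym eqn_mod_dvd ?leq_mul // -mulnBr Gauss_dvdr 1?coprime_sym //.
by rewrite -eqn_mod_dvd // eq_sym.
Qed.

Lemma comb_inj (a b x y x' y' : nat) : coprime a b -> x < b -> x' < b ->
  a * x + b * y = a * x' + b * y' -> x = x' /\ y = y'.
Proof.
move=> hab xb x'b e; have := eq_mod_of_comb _ _ _ _ _ _ hab e.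
rewrite !modn_small // => exx'; split=> //; rewrite exx' in e; nia.
Qed.

Lemma NR_comb (a b x y : nat) : coprime a b -> x < b -> y < a ->
  a * b < a * x + b * y -> NR a b (a * x + b * y - a * b).
Proof.
move=> hab xb ya lt; split=> [|u v e]; first by rewrite subn_gt0.
have e' : a * x + b * y = a * (u + b) + b * v by lia.
have := eq_mod_of_comb _ _ _ _ _ _ hab e'.
rewrite modnDr modn_small // => ex.
(* As [x] is the residue of [u], [x <= u]; then [e'] forces [a * b <= b * y], against [y < a]. *)
have := leq_mod u b; nia.
Qed.

(** Take [x < b] with [a * x] congruent to [m] modulo [b]. Since [m] is not representable, [a * x]
    overshoots it by a positive multiple [b * y], whence [m + a * b = a * x + b * (a - y)]. *)
Lemma NR_exists_comb (a b m : nat) : 0 < a -> 0 < b -> coprime a b ->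
  NR a b m ->
  exists x y, [/\ x < b, y < a & m + a * b = a * x + b * y].
Proof.
move=> ha hb hab [m0 hm].
have [x xb /eqP ex] : exists2 x, x < b & a * x == m %[mod b].
  (* The Chinese remainder is divisible by [a] and congruent to [m] modulo [b]. *)
  exists (chinese a b 0 m %/ a %% b); first by rewrite ltn_mod.
  rewrite modnMmr mulnC divnK ?chinese_modr //.
  by rewrite /dvdn chinese_modl // mod0n.
have lt : m < a * x.
  rewrite ltnNge; apply/negP => le.
  have /dvdnP[y ey] : b %| m - a * x by rewrite -eqn_mod_dvd // ex.
  by apply: (hm x y); rewrite [b * y]mulnC -ey subnKC.
have /dvdnP[y ey] : b %| a * x - m by rewrite -eqn_mod_dvd ?ex // ltnW.
have ya : y < a by nia.
by exists x, (a - y); split => //; nia.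
Qed.

Lemma S_E (k a b : nat) : 0 < a -> 0 < b -> coprime a b ->
  S_ k a b =
  \sum_(p : 'I_b * 'I_a | a * b < a * p.1 + b * p.2)
    (a * p.1 + b * p.2 - a * b) ^ k.
Proof.
move=> ha hb hab.
pose P (p : 'I_b * 'I_a) := a * b < a * p.1 + b * p.2.
pose g (p : 'I_b * 'I_a) := a * p.1 + b * p.2 - a * b.
pose s := [seq g p | p <- enum P].
have us : uniq s.
  rewrite map_inj_in_uniq ?enum_uniq // => -[x y] [x' y'].
  rewrite !mem_enum !unfold_in /P /g /= => h h' e.
  (* By [h] and [h'] neither subtraction truncates. *)
  have e' : a * x + b * y = a * x' + b * y' by lia.
  have [ex ey] := comb_inj _ _ _ _ _ _ hab (ltn_ord x) (ltn_ord x') e'.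
  by congr pair; apply: val_inj.
have NRE : NR a b = [set` s]%classic.
  apply/seteqP; split=> m /=.
    move=> hm; have [x [y [xb ya e]]] := NR_exists_comb _ _ _ ha hb hab hm.
    apply/mapP; exists (Ordinal xb, Ordinal ya); last by rewrite /g /= -e addnK.
    by rewrite mem_enum unfold_in /P /= -e; case: hm => m0 _; lia.
  case/mapP => -[x y]; rewrite mem_enum => hP ->.
  exact: NR_comb.
by rewrite /S_ NRE -fsbig_seq // big_map big_enum.
Qed.

Theorem proposition13 (a b : nat) (ha : 0 < a) (hb : 0 < b)
    (hab : coprime a b) (n : nat) :
  \sum_(a1 < b) \sum_(b1 < a) (a * a1 + b * b1) ^ n * chi a b a1 b1
  = \sum_(i < n.+1) 'C(n, i) * a ^ i * b ^ i * S_ (n - i) a b.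
Proof.
under [RHS]eq_bigr => i _ do rewrite S_E // big_distrr /=.
(* Both sides become sums over all pairs, compared term by term. *)
rewrite [RHS]exchange_big /= pair_big /= [RHS]big_mkcond /=.
apply: eq_bigr => -[x y] _ /=; rewrite chiE.
case: ifP => h; last by rewrite muln0.
(* Split the base as [m + a * b], with [m] the gap attached to the pair. *)
rewrite muln1 -{1}(subnK (ltnW h)) expnDn.
by apply: eq_bigr => i _; rewrite expnMn; lia.
Qed.
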